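(* Let $m$ be a positive integer. Let $S$ be any subset of $\overline{\mathbb{Q}}^m$ that is closed under complex conjugation and satisfies $(0,\ldots,0)\in S$. Then there exist uncountably many transcendental entire functions $f:\mathbb{C}^m\to\mathbb{C}$ with $f\in\mathbb{Q}[[z_1,\ldots,z_m]]$ whose exceptional set is $S$, i.e. $S_f=S$.
   Context: $\overline{\mathbb{Q}}\subseteq\mathbb{C}$ denotes the field of all algebraic numbers. Complex conjugation on $\mathbb{C}^m$ is taken coordinatewise: $\overline{(\alpha_1,\ldots,\alpha_m)}=(\overline{\alpha_1},\ldots,\overline{\alpha_m})$; $S$ is closed under complex conjugation if $u\in S$ implies $\overline{u}\in S$. An entire function is an analytic function $f:\mathbb{C}^m\to\mathbb{C}$. It is algebraic (over $\mathbb{C}(z_1,\ldots,z_m)$) if there is a nonzero polynomial $P\in\mathbb{C}[z_1,\ldots,z_m,z_{m+1}]$ with $P(z_1,\ldots,z_m,f(z_1,\ldots,z_m))=0$ for all $(z_1,\ldots,z_m)\in\mathbb{C}^m$; it is transcendental if it is not algebraic. For a subset $\mathbb{K}\subseteq\mathbb{C}$ and an entire function $f$, one writes $f\in\mathbb{K}[[z_1,\ldots,z_m]]$ if $f(z_1,\ldots,z_m)=\sum_{(k_1,\ldots,k_m)\in\mathbb{Z}_{\geq 0}^m}c_{k_1,\ldots,k_m}z_1^{k_1}\cdots z_m^{k_m}$ for all $(z_1,\ldots,z_m)\in\mathbb{C}^m$, with $c_{k_1,\ldots,k_m}\in\mathbb{K}$ for all $(k_1,\ldots,k_m)\in\mathbb{Z}_{\geq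 0}^m$. The exceptional set of an entire function $f:\mathbb{C}^m\to\mathbb{C}$ is $S_f:=\{(\alpha_1,\ldots,\alpha_m)\in\overline{\mathbb{Q}}^m : f(\alpha_1,\ldots,\alpha_m)\in\overline{\mathbb{Q}}\}$. *)

(* Defs.v *)
From HB Require Import structures.
From mathcomp Require Import all_boot all_order all_algebra.
From mathcomp Require Import mxpoly.
From mathcomp Require Import complex.
From mathcomp Require Import -(notations) mpoly.
From mathcomp Require Import boolp classical_sets functions cardinality.
From mathcomp Require Import reals topology normedtype.
From mathcomp.analysis.showcase Require Import summability.

Set Implicit Arguments.
Unset Strict Implicit.
Unset Printing Implicit Defensive.

Import Order.TTheory GRing.Theory Num.Theory.
Import numFieldNormedType.Exports.

Local Open Scope classical_set_scope.
Local Open Scope ring_scope.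
Local Open Scope complex_scope.

(* The library puts the topology and norm of a numFieldType K on K^o and on the
   abstract carriers; this transfers them to the concrete type R[i], so that
   'rV[R[i]]_m is C^m with its usual topology. *)
HB.instance Definition _ (R : rcfType) := NormedModule.copy R[i] R[i]^o.

Section Defs.
Variable R : realType.
Local Notation C := R[i].

Definition rationals : set C := range (ratr : rat -> C).

Definition algebraic_numbers : set C :=
  [set x | algebraicOver (ratr : rat -> C) x].

Section Multivariate.
Variable m : nat.

Definition algebraic_points : set 'rV[C]_m :=
  [set a | forall i, algebraic_numbers (a 0 i)].

Definition conj_closed (S : set 'rV[C]_m) :=
  forall u, S u -> S (map_mx conjc u).

(* [mmap1 h k] is the monomial \prod_i h i ^+ k i, and [totally] is the
   filter of finite sets of indices directed by inclusion: multiple series are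
   summed unconditionally, which for complex terms amounts to absolute
   convergence, with no preferred ordering of the multi-indices. *)
Definition power_series_sum (c : multinom m -> C) (w : 'rV[C]_m) (s : C) :=
  partial_sum (fun k : multinom m => c k * mmap1 (w 0) k) @ totally --> s.

Definition analytic_at (f : 'rV[C]_m -> C) (a : 'rV[C]_m) :=
  exists c, \forall z \near a, power_series_sum c (z - a) (f z).

Definition entire (f : 'rV[C]_m -> C) := forall a, analytic_at f a.

(* P is evaluated at (z_1, ..., z_m, f z). *)
Definition algebraic_fun (f : 'rV[C]_m -> C) :=
  exists2 P : mpoly (m + 1) C, P != 0 &
    forall z, meval (row_mx z (const_mx (f z) : 'rV_1) 0) P = 0.

Definition transcendental (f : 'rV[C]_m -> C) := ~ algebraic_fun f.

Definition power_series_over (K : set C) (f : 'rV[C]_m -> C) :=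
  exists c, (forall k, K (c k)) /\ (forall z, power_series_sum c z (f z)).

Definition exceptional_set (f : 'rV[C]_m -> C) : set 'rV[C]_m :=
  [set a | algebraic_points a /\ algebraic_numbers (f a)].

End Multivariate.
End Defs.

Arguments rationals {R}.
Arguments algebraic_numbers {R}.
Arguments algebraic_points {R m}.

(* Main.v *)
Require Import Defs.
From mathcomp Require Import all_boot all_order all_algebra.
From mathcomp Require Import finmap.
From mathcomp Require Import complex.
From mathcomp Require Import -(notations) mpoly.
From mathcomp Require Import boolp classical_sets cardinality.
From mathcomp Require Import reals constructive_ereal topology normedtype sequences exp.
From mathcomp Require Import lebesgue_measure.
From mathcomp.analysis.showcase Require Import summability.
From mathcomp Require Import ring lra.

Set Implicit Arguments.
Unset Strict Implicit.
Unset Printing Implicit Defensive.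
Import Order.TTheory GRing.Theory Num.Theory.
Import numFieldNormedType.Exports.

Local Open Scope classical_set_scope.
Local Open Scope ring_scope.
Local Open Scope complex_scope.

Import Normc.

(** The function is f = exp(z_1 + ... + z_m) + lim p_n, where the p_n are
    polynomials with real coefficients built by successive small perturbations along
    an enumeration u_0, u_1, ... of the algebraic points.

    The perturbation of stage n has order at least n+1 at the origin, vanishes at the
    points u_j with j < n, and has coefficients so small that the coefficients of f
    stay between half and twice those of the exponential. It makes the coefficients of
    degree n+1 rational ([rationalize]) and moves the value at u_n to where it belongs:
    into the algebraic numbers if u_n is in S ([adjust_algebraic], by density of the
    Gaussian rationals), out of them otherwise ([adjust_avoid], by countability). Every
    coefficient of f and every value of f at an algebraic point is thus settled at a
    finite stage. Real coefficients only force f(conj z) = conj(f(z)), which is why S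
    has to be closed under conjugation, and the constant coefficient 1 accounts for the
    origin. Points are told apart by one linear form with real coefficients that is
    injective on the algebraic points ([moment_separates]), which turns the
    construction of polynomials vanishing at some points and not at others into a
    matter of one variable.

    The size of the coefficients makes f entire ([entire_psum]), and their positivity
    makes it transcendental: f grows faster than any polynomial in the direction of
    positive coordinates, along which a Kronecker substitution exhibits a dominant
    monomial in any polynomial relation ([transcendental_psum]).

    There are uncountably many such functions by a diagonal argument: given functions
    g_0, g_1, ..., the value at u_n can in addition be chosen different from g_j(u_n)
    for all j <= n, so that f is none of the g_j ([limit_diagonal]). *)

(** * Modulus of complex numbers *)

Section Modulus.
Variable R : realType.
Implicit Types x y : R[i].

Lemma normrcE x : `|x| = (normc x)%:C.
Proof. by []. Qed.

Lemma normcD_le x y : normc (x + y) <= normc x + normc y.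
Proof. exact: le_normcD. Qed.

Lemma normc_opp x : normc (- x) = normc x.
Proof. exact: normcN. Qed.

Lemma normc_ge0 x : 0 <= normc x.
Proof. by rewrite -ler0c -normrcE. Qed.

Lemma normc_ofreal (r : R) : normc r%:C = `|r|.
Proof. by rewrite /normc /= expr0n addr0 sqrtr_sqr. Qed.

Lemma normc_exp x n : normc (x ^+ n) = normc x ^+ n.
Proof.
elim: n => [|n IH]; first by rewrite !expr0 normc1.
by rewrite !exprS normcM IH.
Qed.

Lemma normc_sum (I : Type) (r : seq I) (P : pred I) (F : I -> R[i]) :
  normc (\sum_(i <- r | P i) F i) <= \sum_(i <- r | P i) normc (F i).
Proof.
elim/big_rec2: _ => [|i y x _ le]; first by rewrite normc0.
by rewrite (le_trans (normcD_le _ _)) // lerD2l.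
Qed.

Lemma normc_prod (I : Type) (r : seq I) (P : pred I) (F : I -> R[i]) :
  normc (\prod_(i <- r | P i) F i) = \prod_(i <- r | P i) normc (F i).
Proof.
by elim/big_rec2: _ => [|i y x _ <-]; rewrite ?normc1 ?normcM.
Qed.

Lemma normci : normc 'i%C = 1 :> R.
Proof. by rewrite /normc /= expr0n expr1n add0r sqrtr1. Qed.

Lemma normc_conj x : normc (conjc x) = normc x.
Proof. by case: x => a b; rewrite /normc /= sqrrN. Qed.

Lemma normc_Re x : `|complex.Re x| <= normc x.
Proof. by rewrite -lecR -normrcE normc_ge_Re. Qed.

End Modulus.

(** * Unconditional sums of complex families *)

Section Families.
Variables (R : realType) (I : choiceType).
Local Notation C := R[i].
Implicit Types (x y : I -> C) (s t : C) (A B : {fset I}).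
Local Open Scope fset_scope.
Local Open Scope ring_scope.

(** The epsilon form of convergence along the filter of finite subsets; all the
    estimates below are made on finite sums, so this form is the convenient one. *)
Definition sums_to x s := forall e : R, 0 < e ->
  exists A, forall B, A `<=` B -> normc (\sum_(i <- B) x i - s) < e.

Lemma sums_to_cvg x s : sums_to x s -> partial_sum x @ totally --> s.
Proof.
have FF := @totally_filter I.
move=> xs; apply/cvgrPdist_lt => -[e f]; rewrite ltcE /= => /andP[/eqP-> e0].
have [A HA] := xs e e0.
exists A => //= B AB; rewrite distrC normrcE ltcR.
have -> : partial_sum x B = \sum_(i <- B) x i by rewrite big_seq_fsetE.
exact: HA.
Qed.

Lemma sums_to_ext x y s : x =1 y -> sums_to x s -> sums_to y s.
Proof.
move=> xy xs e e0; have [A HA] := xs e e0; exists A => B AB.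
by rewrite -(eq_bigr _ (fun i _ => xy i)); exact: HA.
Qed.

Lemma sums_toD x y s t :
  sums_to x s -> sums_to y t -> sums_to (fun i => x i + y i) (s + t).
Proof.
move=> xs yt e e0; have e2 : 0 < e / 2 by rewrite divr_gt0.
have [A HA] := xs _ e2; have [B HB] := yt _ e2.
exists (A `|` B) => D; rewrite fsubUset => /andP[AD BD].
rewrite big_split /= opprD addrACA (le_lt_trans (normcD_le _ _)) //.
by rewrite [e]splitr ltrD // ?HA ?HB.
Qed.

Lemma sums_toZ a x s : sums_to x s -> sums_to (fun i => a * x i) (a * s).
Proof.
move=> xs e e0; have a1 : 0 < normc a + 1 by rewrite ltr_wpDl ?normc_ge0.
have [A HA] := xs (e / (normc a + 1)) (divr_gt0 e0 a1).
exists A => B AB; rewrite -mulr_sumr -mulrBr normcM.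
have := HA _ AB; rewrite ltr_pdivlMr // => le.
apply: le_lt_trans le; rewrite mulrC ler_wpM2l ?normc_ge0 //.
by rewrite lerDl.
Qed.

Lemma sums_to0 : sums_to (fun=> 0) 0.
Proof. by move=> e e0; exists fset0 => B _; rewrite big1 // subr0 normc0. Qed.

Lemma sums_to_sum (J : Type) (r : seq J) (x : J -> I -> C) (s : J -> C) :
  (forall j, sums_to (x j) (s j)) ->
  sums_to (fun i => \sum_(j <- r) x j i) (\sum_(j <- r) s j).
Proof.
move=> xs; elim: r => [|j r IH].
  by rewrite big_nil; apply: sums_to_ext sums_to0 => i; rewrite big_nil.
rewrite big_cons; apply: sums_to_ext (sums_toD (xs j) IH) => i.
by rewrite big_cons.
Qed.

Lemma sums_toB x y s t :
  sums_to x s -> sums_to y t -> sums_to (fun i => x i - y i) (s - t).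
Proof.
move=> xs /(sums_toZ (-1)) yt; rewrite -mulN1r.
by apply: sums_to_ext (sums_toD xs yt) => i; rewrite mulN1r.
Qed.

Lemma sums_to_le x s (M : R) :
  (forall B, normc (\sum_(i <- B) x i) <= M) ->
  sums_to x s -> normc s <= M.
Proof.
move=> le xs; apply/ler_addgt0Pr => e e0; have [D HD] := xs e e0.
have := HD D (fsubset_refl _); have := le D.
set T := \sum_(i <- _) _ => leT ltT.
have -> : s = T - (T - s) by rewrite subKr.
by rewrite (le_trans (normcD_le _ _)) // normc_opp lerD // ltW.
Qed.

Lemma sums_to_ge x s (M : R) A :
  (forall B, A `<=` B -> M <= normc (\sum_(i <- B) x i)) ->
  sums_to x s -> M <= normc s.
Proof.
move=> le xs; apply/ler_addgt0Pr => e e0; have [D HD] := xs e e0.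
have := HD (A `|` D) (fsubsetUr _ _); have := le (A `|` D) (fsubsetUl _ _).
set T := \sum_(i <- _) _ => leT ltT; apply: (le_trans leT).
rewrite -[T](subrK s) addrC (le_trans (normcD_le _ _)) // lerD //; exact: ltW.
Qed.

Lemma sums_to_uniq x s t : sums_to x s -> sums_to x t -> s = t.
Proof.
move=> xs xt; apply/eqP; rewrite -subr_eq0; apply/eqP/eq0_normc/le_anti.
rewrite normc_ge0 andbT; apply: sums_to_le (sums_toB xs xt).
by move=> B; rewrite big1 ?normc0 // => i _; rewrite subrr.
Qed.

Lemma sums_to_conj x s :
  sums_to x s -> sums_to (fun i => conjc (x i)) (conjc s).
Proof.
move=> xs e e0; have [A HA] := xs e e0; exists A => B AB.
by rewrite -rmorph_sum -rmorphB normc_conj HA.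
Qed.

Lemma sums_to_finite x (r : seq I) : uniq r -> (forall i, i \notin r -> x i = 0) ->
  sums_to x (\sum_(i <- r) x i).
Proof.
move=> ur x0 e e0; exists [fset i in r] => B rB.
suff -> : \sum_(i <- B) x i = \sum_(i <- r) x i by rewrite subrr normc0.
rewrite (bigID (mem r)) /= [X in _ + X]big1 ?addr0 => [|i /x0 //].
rewrite -big_filter; apply/perm_big/uniq_perm => //.
  by rewrite filter_uniq // fset_uniq.
move=> i; rewrite mem_filter; case: (boolP (i \in r)) => //= ir.
by apply: (fsubsetP rB); rewrite in_fset.
Qed.

Definition abs_bounded x (M : R) := forall B, \sum_(i <- B) normc (x i) <= M.

Lemma sum_uniq_le (F : I -> R) (r s : seq I) : uniq r -> uniq s ->
  (forall i, 0 <= F i) -> {in r, forall i, i \notin s -> F i = 0} ->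
  \sum_(i <- r) F i <= \sum_(i <- s) F i.
Proof.
move=> ur us F0 rs; rewrite (bigID (mem s)) /= [X in _ + X]big1_seq ?addr0; last first.
  by move=> i /andP[is_ ir]; exact: rs.
rewrite [leRHS](bigID (mem r)) /= -big_filter -[X in _ <= X + _]big_filter.
rewrite (perm_big [seq i <- s | i \in r]); last first.
  apply: uniq_perm => [||i]; rewrite ?filter_uniq //.
  by rewrite !mem_filter andbC.
by rewrite lerDl sumr_ge0.
Qed.

Lemma fset_sum_le (F : I -> R) A B : (forall i, 0 <= F i) -> A `<=` B ->
  \sum_(i <- A) F i <= \sum_(i <- B) F i.
Proof.
move=> F0 AB; apply: sum_uniq_le; rewrite ?fset_uniq // => i /(fsubsetP AB) ->.
by [].
Qed.

Lemma nonneg_sup (F : I -> R) (M : R) : (forall i, 0 <= F i) ->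
  (forall B, \sum_(i <- B) F i <= M) ->
  exists2 s : R, (forall B, \sum_(i <- B) F i <= s) &
    forall e, 0 < e -> exists A, s - e < \sum_(i <- A) F i.
Proof.
move=> F0 leM; pose E := [set s | exists B, s = \sum_(i <- B) F i].
have Esup : has_sup E.
  split; first by exists (\sum_(i <- fset0) F i), fset0.
  by exists M => _ [B ->].
exists (sup E) => [B|e e0].
  by apply: sup_upper_bound => //; exists B.
by have [_ [A ->]] := sup_adherent e0 Esup; exists A.
Qed.

Lemma sums_to_nonneg (F : I -> R) (M : R) : (forall i, 0 <= F i) ->
  (forall B, \sum_(i <- B) F i <= M) -> exists s, sums_to (fun i => (F i)%:C) s.
Proof.
move=> F0 leM; have [s les sa] := nonneg_sup F0 leM.
exists s%:C => e e0; have [A HA] := sa e e0; exists A => B AB.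
rewrite -rmorph_sum -rmorphB normc_ofreal ltr_distl; apply/andP; split.
  by rewrite (lt_le_trans HA) // fset_sum_le.
by rewrite (le_lt_trans (les B)) ?ltrDl.
Qed.

(** A finite set on which the sum is within e of its supremum leaves at most e for
    any disjoint finite set. *)
Lemma nonneg_tail (F : I -> R) (M : R) : (forall i, 0 <= F i) ->
  (forall B, \sum_(i <- B) F i <= M) -> forall e, 0 < e ->
  exists A, forall B, {in B, forall i, i \notin A} -> \sum_(i <- B) F i <= e.
Proof.
move=> F0 leM e e0; have [s les sa] := nonneg_sup F0 leM.
have [A HA] := sa e e0; exists A => B AB.
have := les (A `|` B).
rewrite (perm_big ((A : seq I) ++ (B : seq I))); last first.
  apply: uniq_perm => [||i]; first exact: fset_uniq.
    by rewrite cat_uniq !fset_uniq andbT; apply/hasPn => i /AB.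
  by rewrite mem_cat in_fsetU.
by rewrite big_cat /= => le; lra.
Qed.

(** Both |F| + F and |F| - F are nonnegative with bounded partial sums, and F is
    half of their difference. *)
Lemma sums_to_real (F : I -> R) (M : R) :
  (forall B, \sum_(i <- B) `|F i| <= M) -> exists s, sums_to (fun i => (F i)%:C) s.
Proof.
move=> leM; pose P i := `|F i| + F i; pose N i := `|F i| - F i.
have [s Ps] : exists s, sums_to (fun i => (P i)%:C) s.
  apply: (@sums_to_nonneg P (M + M)) => [i|B].
    by rewrite /P -lerBlDr sub0r -normrN ler_norm.
  rewrite big_split lerD //; apply: le_trans (leM B).
  by apply: ler_sum => i _; exact: ler_norm.
have [t Nt] : exists s, sums_to (fun i => (N i)%:C) s.
  apply: (@sums_to_nonneg N (M + M)) => [i|B].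
    by rewrite /N subr_ge0 ler_norm.
  rewrite big_split lerD //; apply: le_trans (leM B).
  by apply: ler_sum => i _; rewrite -normrN ler_norm.
exists ((2^-1)%:C * (s - t)).
apply: sums_to_ext (sums_toZ _ (sums_toB Ps Nt)) => i.
rewrite -rmorphB -rmorphM; congr (_%:C); rewrite /P /N; by field.
Qed.

(** Absolutely bounded complex families are summable: the real and the imaginary
    parts are absolutely bounded real families. *)
Lemma sums_to_exists x (M : R) : abs_bounded x M -> exists s, sums_to x s.
Proof.
move=> xM.
have [s xs] : exists s, sums_to (fun i => (complex.Re (x i))%:C) s.
  apply: (@sums_to_real _ M) => B; apply: le_trans (xM B).
  by apply: ler_sum => i _; exact: normc_Re.
have [t xt] : exists s, sums_to (fun i => (complex.Im (x i))%:C) s.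
  apply: (@sums_to_real _ M) => B; apply: le_trans (xM B).
  apply: ler_sum => i _; rewrite -normrN -ReiNIm (le_trans (normc_Re _)) //.
  by rewrite normcM normci mulr1.
exists (s + 'i%C * t).
by apply: sums_to_ext (sums_toD xs (sums_toZ 'i%C xt)) => i; rewrite -complexE.
Qed.

(** Equal to 0 when the family is not summable. *)
Definition family_sum x : C := xget 0 [set s | sums_to x s].

Lemma family_sumP x (M : R) : abs_bounded x M -> sums_to x (family_sum x).
Proof. by move=> /sums_to_exists[s xs]; apply: (@xgetPex _ 0); exists s. Qed.

End Families.

(** * Everywhere convergent power series are entire *)

Section PowerSeries.
Variables (R : realType) (m : nat).
Local Notation C := R[i].
Implicit Types (k j : multinom m) (z w : 'rV[C]_m).
Local Open Scope fset_scope.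
Local Open Scope ring_scope.

Definition invfact (k : multinom m) : R := \prod_(i < m) ((k i)`!%:R)^-1.

Lemma invfact_gt0 k : 0 < invfact k.
Proof. by apply: prodr_gt0 => i _; rewrite invr_gt0 ltr0n fact_gt0. Qed.

Lemma mmap1_ge0 (r : 'I_m -> R) k : (forall i, 0 <= r i) -> 0 <= mmap1 r k.
Proof. by move=> r0; apply: prodr_ge0 => i _; rewrite exprn_ge0. Qed.

Lemma normc_mmap1 (h : 'I_m -> C) k :
  normc (mmap1 h k) = mmap1 (fun i => normc (h i)) k.
Proof. by rewrite normc_prod; apply: eq_bigr => i _; rewrite normc_exp. Qed.

Lemma exp_partial_sum_le (r : R) N : 0 <= r ->
  \sum_(n < N) (n`!%:R)^-1 * r ^+ n <= expR r.
Proof.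
move=> r0; rewrite -(big_mkord xpredT (fun n => (n`!%:R)^-1 * r ^+ n)).
have -> : \sum_(0 <= n < N) (n`!%:R)^-1 * r ^+ n = series (exp_coeff r) N.
  by apply: eq_bigr => n _; rewrite /exp_coeff /= mulrC.
apply: nondecreasing_cvgn_le; last exact: is_cvg_series_exp_coeff.
apply/nondecreasing_seqP => n.
by rewrite /series /= big_nat_recr //= lerDl exp_coeff_ge0.
Qed.

(** The series with coefficients [invfact] is that of exp(z_1 + ... + z_m). *)
Lemma exp_series_le (r : 'I_m -> R) (B : {fset multinom m}) :
  (forall i, 0 <= r i) ->
  \sum_(k <- B) invfact k * mmap1 r k <= \prod_(i < m) expR (r i).
Proof.
move=> r0.
pose N := (\max_(k <- B) mdeg k).+1.
pose t (i : 'I_m) (n : nat) := (n`!%:R)^-1 * r i ^+ n.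
have t0 i n : 0 <= t i n by rewrite mulr_ge0 ?invr_ge0 ?ler0n ?exprn_ge0.
have tE k : invfact k * mmap1 r k = \prod_(i < m) t i (k i).
  by rewrite -big_split.
(* The indices in B embed into the box [0, N)^m, over which the sum of products
   is the product of the sums. *)
pose F k : {ffun 'I_m -> 'I_N} := [ffun i => inord (k i)].
have FE k : k \in B -> forall i, F k i = k i :> nat.
  move=> kB i; rewrite ffunE inordK // ltnS.
  apply: (@leq_trans (mdeg k)); last by rewrite leq_bigmax_seq.
  by rewrite mdegE (bigD1 i) //= leq_addr.
apply: (@le_trans _ _ (\sum_(f : {ffun 'I_m -> 'I_N}) \prod_(i < m) t i (f i))).
  rewrite (eq_big_seq (fun k => \prod_(i < m) t i (F k i))) => [|k kB]; last first.
    by rewrite tE; apply: eq_bigr => i _; rewrite FE.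
  rewrite -(big_map F xpredT (fun f => \prod_(i < m) t i (f i))).
  apply: sum_uniq_le.
  - rewrite map_inj_in_uniq ?fset_uniq // => k1 k2 k1B k2B /ffunP FF.
    by apply/mnmP => i; rewrite -FE // FF FE.
  - exact: index_enum_uniq.
  - by move=> f; rewrite prodr_ge0.
  - by move=> f _; rewrite mem_index_enum.
rewrite -(bigA_distr_bigA (fun i (n : 'I_N) => t i n)).
apply: ler_prod => i _; rewrite sumr_ge0 //= exp_partial_sum_le //.
Qed.

(** Domination by the coefficients of an exponential is what makes a power series
    converge absolutely on the whole space. *)
Definition dominated (c : multinom m -> C) (K : R) :=
  forall k, normc (c k) <= K * invfact k.

Lemma dominated_sum_le c K (r : 'I_m -> R) (B : {fset multinom m}) :
  dominated c K -> (forall i, 0 <= r i) ->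
  \sum_(k <- B) normc (c k) * mmap1 r k <= K * \prod_(i < m) expR (r i).
Proof.
move=> cK r0; have K0 : 0 <= K.
  have := le_trans (normc_ge0 _) (cK mnm0).
  by rewrite pmulr_lge0 // invfact_gt0.
apply: le_trans (ler_wpM2l K0 (exp_series_le B r0)).
rewrite mulr_sumr; apply: ler_sum => k _; rewrite mulrA.
by rewrite ler_wpM2r // mmap1_ge0.
Qed.

Definition psum (c : multinom m -> C) (z : 'rV[C]_m) : C :=
  family_sum (fun k => c k * mmap1 (z 0) k).

Lemma dominated_bounded c K z : dominated c K ->
  abs_bounded (fun k => c k * mmap1 (z 0) k)
    (K * \prod_(i < m) expR (normc (z 0 i))).
Proof.
pose r i := normc (z 0 i).
move=> cK B; rewrite (eq_bigr (fun k => normc (c k) * mmap1 r k)).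
  by apply: dominated_sum_le => // i; exact: normc_ge0.
by move=> k _; rewrite normcM normc_mmap1.
Qed.

Lemma psumP c K z : dominated c K ->
  sums_to (fun k => c k * mmap1 (z 0) k) (psum c z).
Proof. by move=> cK; apply/family_sumP/(dominated_bounded z cK). Qed.

Lemma psum_le c K z : dominated c K ->
  normc (psum c z) <= K * \prod_(i < m) expR (normc (z 0 i)).
Proof.
move=> cK; apply: sums_to_le (psumP z cK) => B.
exact: le_trans (normc_sum _ _ _) (dominated_bounded z cK B).
Qed.

(** The monomial with exponent k, expanded around the point a. *)
Definition shift (K : comNzRingType) (a : 'I_m -> K) (k : multinom m) : mpoly m K :=
  mmap1 (fun i => mpolyX K (mnm1 i) + mpolyC m (a i)) k.

Lemma meval_shift (K : comNzRingType) (a w : 'I_m -> K) k :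
  meval w (shift a k) = mmap1 (fun i => w i + a i) k.
Proof.
rewrite /shift /mmap1 rmorph_prod /=; apply: eq_bigr => i _.
by rewrite rmorphXn /= mevalD mevalXU mevalC.
Qed.

(** Coefficientwise domination by a polynomial with nonnegative coefficients; being
    stable under products, it bounds the expansion of a shifted monomial without
    binomial coefficients. *)
Definition majorized (p : mpoly m C) (P : mpoly m R) :=
  forall k, normc (mcoeff k p) <= mcoeff k P.

Lemma majorizedM p q P Q :
  majorized p P -> majorized q Q -> majorized (p * q) (P * Q).
Proof.
move=> pP qQ k; rewrite !mcoeffM (le_trans (normc_sum _ _ _)) //.
by apply: ler_sum => j _; rewrite normcM ler_pM ?normc_ge0.
Qed.

Lemma normc_natb (b : bool) : normc (b%:R : C) = b%:R.
Proof. by case: b; rewrite ?normc1 ?normc0. Qed.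

Lemma majorized1 : majorized 1 1.
Proof. by move=> k; rewrite !mcoeff1 normc_natb. Qed.

Lemma majorized_shift (a : 'I_m -> C) k :
  majorized (shift a k) (shift (fun i => normc (a i)) k).
Proof.
rewrite /shift /mmap1; elim/big_rec2: _ => [|i P p _ pP]; first exact: majorized1.
apply: majorizedM => //; elim: (k i) => [|n IH]; first exact: majorized1.
rewrite !exprS; apply: majorizedM => // {IH}j.
rewrite !mcoeffD !mcoeffX !mcoeffC (le_trans (normcD_le _ _)) //.
by rewrite normcM !normc_natb.
Qed.

(** Evaluating the majorant of the expansion of (X + a)^k at |w| gives
    (|w| + |a|)^k. *)
Lemma shift_sum_le (a w : 'I_m -> C) k (r : seq (multinom m)) : uniq r ->
  \sum_(j <- r) normc (mcoeff j (shift a k) * mmap1 w j) <=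
    mmap1 (fun i => normc (w i) + normc (a i)) k.
Proof.
move=> ur; pose P := shift (fun i => normc (a i)) k.
have PP := majorized_shift a k.
have w0 j : 0 <= mmap1 (fun i => normc (w i)) j.
  by apply: mmap1_ge0 => i; exact: normc_ge0.
apply: (@le_trans _ _ (\sum_(j <- r) mcoeff j P * mmap1 (fun i => normc (w i)) j)).
  by apply: ler_sum => j _; rewrite normcM normc_mmap1 ler_wpM2r.
rewrite -meval_shift /meval /mmap; apply: sum_uniq_le => //.
- exact: msupp_uniq.
- by move=> j; rewrite mulr_ge0 // (le_trans (normc_ge0 _) (PP j)).
- by move=> j _ jP; rewrite /= memN_msupp_eq0 // mul0r.
Qed.

(** The Taylor coefficients at a are the sums over k of the coefficients of
    c_k (X + a)^k. Only the exponents k outside a large finite set contribute to the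
    difference between f(a + w) and a large partial sum of the Taylor series, and they
    contribute at most the tail of the series of |c_k| (|a| + |w|)^k. *)
Lemma entire_psum c K : dominated c K -> entire (psum c).
Proof.
move=> cK a; pose s k := shift (a 0) k.
pose d j := family_sum (fun k => c k * mcoeff j (s k)).
exists d; have FF : Filter (nbhs a) by exact: nbhs_filter.
apply: (@nearW _ (nbhs a)) => z; apply: sums_to_cvg.
set w := z - a.
pose r i := normc (w 0 i) + normc (a 0 i).
have r0 i : 0 <= r i by rewrite addr_ge0 ?normc_ge0.
have dP j : sums_to (fun k => c k * mcoeff j (s k)) (d j).
  apply: (@family_sumP _ _ _ (K * \prod_(i < m) expR (normc 1 + normc (a 0 i)))) => B.
  have r1 i : 0 <= normc (1 : C) + normc (a 0 i) by rewrite addr_ge0 ?normc_ge0.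
  apply: le_trans (dominated_sum_le B cK r1); apply: ler_sum => k _.
  rewrite normcM ler_wpM2l ?normc_ge0 //.
  have := @shift_sum_le (a 0) (fun=> 1) k [:: j] isT.
  rewrite big_seq1 normcM normc_mmap1 [mmap1 _ j]big1 ?mulr1 // => i _.
  by rewrite normc1 expr1n.
have mE k : mmap1 (z 0) k = \sum_(j <- msupp (s k)) mcoeff j (s k) * mmap1 (w 0) j.
  rewrite -[RHS]/(meval (w 0) (s k)) meval_shift; apply: mmap1_eq => i.
  by rewrite !mxE subrK.
have F0 k : 0 <= normc (c k) * mmap1 r k by rewrite mulr_ge0 ?normc_ge0 ?mmap1_ge0.
move=> e e0; have e2 : 0 < e / 2 by rewrite divr_gt0.
(* Once J contains all exponents of the finitely many polynomials [s k] with k in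
   A, only the tail of the series outside A can differ. *)
have [A HA] := nonneg_tail F0 (fun B => dominated_sum_le B cK r0) e2.
exists [fset j in flatten [seq msupp (s k) | k <- A]] => J AJ.
apply: (@le_lt_trans _ _ (e / 2)); last by lra.
pose y k := \sum_(j <- J) c k * mcoeff j (s k) * mmap1 (w 0) j - c k * mmap1 (z 0) k.
have yE k : y k = - (c k * \sum_(j <- msupp (s k) | j \notin J)
                             mcoeff j (s k) * mmap1 (w 0) j).
  rewrite /y mE [in X in _ - X](bigID (mem J)) /= mulrDr opprD addrA.
  suff -> : \sum_(j <- J) c k * mcoeff j (s k) * mmap1 (w 0) j =
     c k * \sum_(j <- msupp (s k) | j \in J) mcoeff j (s k) * mmap1 (w 0) j.
    by rewrite subrr add0r.
  rewrite mulr_sumr (bigID (mem (msupp (s k)))) /= [X in _ + X]big1 ?addr0; last first.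
    by move=> j jP; rewrite memN_msupp_eq0 // mulr0 mul0r.
  rewrite -big_filter -[RHS]big_filter (perm_big [seq j <- msupp (s k) | j \in J]).
    by apply: eq_bigr => j _; rewrite mulrA.
  apply: uniq_perm => [||j]; rewrite ?filter_uniq ?fset_uniq ?msupp_uniq //.
  by rewrite !mem_filter andbC.
have y_le k : normc (y k) <= normc (c k) * mmap1 r k.
  rewrite yE normc_opp normcM ler_wpM2l ?normc_ge0 // -big_filter.
  rewrite (le_trans (normc_sum _ _ _)) // shift_sum_le // filter_uniq // msupp_uniq.
have y_A k : k \in A -> y k = 0.
  move=> kA; rewrite yE big1_seq ?mulr0 ?oppr0 // => j /andP[jJ jk].
  case/negP: jJ; apply: (fsubsetP AJ); rewrite in_fset.
  by apply/flattenP; exists (msupp (s k)) => //; apply/mapP; exists k.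
have ys : sums_to y (\sum_(j <- J) d j * mmap1 (w 0) j - psum c z).
  apply: sums_toB (psumP z cK); apply: sums_to_sum => j.
  rewrite [d j * _]mulrC; apply: sums_to_ext (sums_toZ _ (dP j)) => k.
  by rewrite mulrC.
apply: sums_to_le ys => B.
rewrite (le_trans (normc_sum _ _ _)) //.
apply: le_trans (HA (B `\` A) _) => [|k]; last by rewrite in_fsetD => /andP[].
apply: (@le_trans _ _ (\sum_(k <- B `\` A) normc (y k))).
  apply: sum_uniq_le; rewrite ?fset_uniq // => k; first exact: normc_ge0.
  by move=> kB; rewrite in_fsetD kB andbT negbK => /y_A->; rewrite normc0.
by apply: ler_sum => k _.
Qed.

End PowerSeries.

(** * Power series with positive coefficients are transcendental *)

Section Transcendence.

Lemma base_sum_lt (N n : nat) (a : 'I_n -> nat) : (forall i, a i < N)%N ->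
  (\sum_(i < n) a i * N ^ i < N ^ n)%N.
Proof.
elim: n a => [|n IH] a aN; first by rewrite big_ord0.
rewrite big_ord_recr /= expnS.
have /(leq_trans _)-> // : (N ^ n + a ord_max * N ^ n <= N * N ^ n)%N.
  by rewrite -mulSn leq_mul2r aN orbT.
by rewrite -addSn leq_add2r; exact: (IH (fun i => a (widen_ord (leqnSn n) i))).
Qed.

Lemma base_sum_inj (N n : nat) (a b : 'I_n -> nat) :
  (forall i, a i < N)%N -> (forall i, b i < N)%N ->
  (\sum_(i < n) a i * N ^ i = \sum_(i < n) b i * N ^ i)%N -> a =1 b.
Proof.
elim: n a b => [|n IH] a b aN bN; first by move=> _ [].
rewrite !big_ord_recr /=.
set A := (\sum_(i < n) _)%N; set B := (\sum_(i < n) _)%N => e.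
have An : (A < N ^ n)%N by apply: (base_sum_lt (a := fun i => a (widen_ord _ i))).
have Bn : (B < N ^ n)%N by apply: (base_sum_lt (a := fun i => b (widen_ord _ i))).
have Nn : (0 < N ^ n)%N by apply: leq_ltn_trans An.
have eAB : A = B.
  have := congr1 (modn^~ (N ^ n)%N) e.
  by rewrite ![(_ + _ * _)%N]addnC !modnMDl !modn_small.
have elast : a ord_max = b ord_max.
  by move/eqP: e; rewrite eAB eqn_add2l eqn_pmul2r // => /eqP.
move=> i; case: (unliftP ord_max i) => [j ->|->] //.
have -> : lift ord_max j = widen_ord (leqnSn n) j.
  by apply/val_inj; rewrite /= /bump leqNgt ltn_ord.
exact: (IH (fun i => a (widen_ord _ i)) (fun i => b (widen_ord _ i))).
Qed.

Variables (R : realType) (m : nat) (hm : (0 < m)%N).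
Local Notation C := R[i].
Local Open Scope fset_scope.
Local Open Scope ring_scope.

(** At a point with nonnegative coordinates all the terms are nonnegative, so that
    the sum dominates each of them. *)
Lemma psum_ge_term (c : multinom m -> R) K (r : 'I_m -> R) k :
  dominated (fun k => (c k)%:C) K -> (forall k, 0 <= c k) -> (forall i, 0 <= r i) ->
  c k * mmap1 r k <= normc (psum (fun k => (c k)%:C) (\row_i (r i)%:C)).
Proof.
move=> cK c0 r0; apply: (sums_to_ge (A := [fset k])) (psumP _ cK) => B kB.
have -> : \sum_(i <- B) (c i)%:C * mmap1 ((\row_i (r i)%:C : 'rV[C]_m) 0) i =
    (\sum_(i <- B) c i * mmap1 r i)%:C.
  rewrite rmorph_sum; apply: eq_bigr => j _; rewrite rmorphM /=; congr (_ * _).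
  by rewrite rmorph_prod; apply: eq_bigr => i _; rewrite mxE rmorphXn.
have F0 j : 0 <= c j * mmap1 r j by rewrite mulr_ge0 ?mmap1_ge0.
rewrite normc_ofreal ger0_norm ?sumr_ge0 //.
by have := fset_sum_le F0 kB; rewrite big_seq_fset1.
Qed.

Lemma mmap1_muln (h : 'I_m -> R) i n : mmap1 h (mnm_muln (mnm1 i) n) = h i ^+ n.
Proof.
rewrite /mmap1 (bigD1 i) //= big1 ?mulr1 => [|j ji].
  by rewrite mulmnE mnm1E eqxx mul1n.
by rewrite mulmnE mnm1E eq_sym (negbTE ji) mul0n expr0.
Qed.

(** Substitute z_i = t^(N^i) with t large and N larger than all exponents of P. The
    monomials in z become distinct powers of t of exponent below N^m (Kronecker
    substitution), whereas f(z) is at least t^(N^m) because all coefficients of f are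
    positive. Hence the monomial of P with the largest degree in the last variable and,
    among those, the largest power of t dominates all the others, and P(z, f(z)) cannot
    vanish. *)
Lemma transcendental_psum (c : multinom m -> R) K :
  dominated (fun k => (c k)%:C) K -> (forall k, 0 < c k) ->
  transcendental (psum (fun k => (c k)%:C)).
Proof.
move=> cK c0 [P P0 PE]; pose N := msize P.
have N0 : (0 < N)%N by rewrite lt0n msize_poly_eq0.
have digit k (i : 'I_(m + 1)) : k \in msupp P -> (k i < N)%N.
  move=> kP; apply: leq_ltn_trans (msize_mdeg_lt kP).
  by rewrite mdegE (bigD1 i) //= leq_addr.
pose y (k : multinom (m + 1)) := k (rshift m ord0).
pose ws (k : multinom (m + 1)) := (\sum_(i < m) k (lshift 1 i) * N ^ i)%N.
pose key (k : multinom (m + 1)) := (\sum_(i < m + 1) k i * N ^ i)%N.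
have keyE k : key k = (ws k + y k * N ^ m)%N.
  by rewrite /key big_split_ord /= big_ord1 /= addn0.
have key_inj k l : k \in msupp P -> l \in msupp P -> key k = key l -> k = l.
  move=> kP lP /base_sum_inj e; apply/mnmP; apply: e => i; exact: digit.
have ws_lt k : k \in msupp P -> (ws k < N ^ m)%N.
  by move=> kP; apply: base_sum_lt => i; exact: digit.
(* With the last variable in the top digit, comparing keys compares the degree
   in that variable first and the weight in the others second. *)
have [k0 k0P k0max] : exists2 k0, k0 \in msupp P &
    forall k, k \in msupp P -> (key k <= key k0)%N.
  have : msupp P != [::] by rewrite msupp_eq0.
  elim: (msupp P) => // k s IH _; have [->|s0] := eqVneq s [::].
    by exists k; rewrite ?mem_head // => l; rewrite inE => /eqP->.
  have [k1 k1s H] := IH s0; case: (leqP (key k) (key k1)) => le.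
    by exists k1; rewrite ?inE ?k1s ?orbT // => l; rewrite inE => /predU1P[->|/H].
  exists k; rewrite ?mem_head // => l; rewrite inE => /predU1P[->//|/H /leq_trans->//].
  exact: ltnW.
pose M := (N ^ m).+1; pose i0 := Ordinal hm.
pose kM := mnm_muln (mnm1 i0) M.
pose S := \sum_(k <- msupp P) normc (mcoeff k P).
have S0 : 0 <= S by apply: sumr_ge0 => k _; exact: normc_ge0.
have q0 : 0 < normc (mcoeff k0 P).
  rewrite lt_neqAle normc_ge0 andbT eq_sym; apply/eqP => /eq0_normc /eqP.
  by rewrite mcoeff_eq0 k0P.
(* The summand 1 gives 1 <= t and strictness at the end, the second makes
   [c kM * t >= 1] and the third lets the monomial of k0 beat all the others. *)
pose t : R := 1 + (c kM)^-1 + S / normc (mcoeff k0 P).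
have t1 : 1 <= t.
  by rewrite /t -addrA lerDl addr_ge0 ?divr_ge0 ?invr_ge0 ?normc_ge0 // ltW.
have t0 : 0 < t by apply: lt_le_trans t1.
pose r (i : 'I_m) := t ^+ (N ^ i).
have r0 i : 0 <= r i by rewrite exprn_ge0 // ltW.
pose Y := psum (fun k => (c k)%:C) (\row_i (r i)%:C).
have Yge : t ^+ (N ^ m) <= normc Y.
  have := psum_ge_term kM cK (fun k => ltW (c0 k)) r0.
  apply: le_trans; rewrite mmap1_muln /r /= expn0 expr1 exprS mulrA.
  rewrite ler_peMl ?exprn_ge0 ?(ltW t0) // -ler_pdivrMl // mulr1.
  rewrite /t -addrA [1 + _]addrC -addrA lerDl.
  by rewrite addr_ge0 // divr_ge0 // normc_ge0.
have Y1 : 1 <= normc Y by apply: le_trans Yge; rewrite exprn_ege1.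
pose T (k : multinom (m + 1)) := t ^+ ws k * normc Y ^+ y k.
have T0 k : 0 < T k by rewrite mulr_gt0 ?exprn_gt0 // (lt_le_trans _ Y1).
have Tle k : k \in msupp P -> k != k0 -> t * T k <= T k0.
  move=> kP kk0; have ltk : (key k < key k0)%N.
    rewrite ltn_neqAle k0max // andbT; apply: contra kk0 => /eqP e.
    by apply/eqP/key_inj.
  rewrite /T mulrA -exprS; case: (ltngtP (y k) (y k0)) => yy.
  - rewrite mulrC; apply: (@le_trans _ _ (normc Y ^+ y k * normc Y)).
      rewrite ler_wpM2l ?exprn_ge0 ?normc_ge0 // (le_trans _ Yge) //.
      by rewrite ler_weXn2l // ws_lt.
    rewrite -exprSr (le_trans (ler_weXn2l Y1 yy)) // ler_peMl ?exprn_ge0 ?normc_ge0 //.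
    by rewrite exprn_ege1.
  - move: ltk; rewrite !keyE ltnNge => /negP[].
    apply: (@leq_trans ((y k0).+1 * N ^ m)).
      by rewrite mulSn leq_add2r ltnW ?ws_lt.
    by apply: leq_trans (leq_addl _ _); rewrite leq_mul2r yy orbT.
  - move: ltk; rewrite !keyE yy ltn_add2r => ltw.
    by rewrite ler_wpM2r ?exprn_ge0 ?normc_ge0 // ler_weXn2l.
have := PE (\row_i (r i)%:C); rewrite -/Y mevalE.
pose V (k : multinom (m + 1)) :=
  \prod_i (row_mx (\row_i (r i)%:C) (const_mx Y : 'rV[C]_1)) 0 i ^+ k i.
rewrite (eq_bigr (fun k => mcoeff k P * V k)) //.
have VE k : normc (V k) = T k.
  rewrite /V big_split_ord /= big_ord1 row_mxEr mxE normcM normc_exp; congr (_ * _).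
  rewrite (eq_bigr (fun i : 'I_m => (t ^+ (k (lshift 1 i) * N ^ i))%:C)) => [|i _].
    rewrite -rmorph_prod normc_ofreal -expr_sum ger0_norm //.
    by rewrite exprn_ge0 // ltW.
  by rewrite row_mxEl mxE -rmorphXn /r -exprM mulnC.
rewrite (bigD1_seq k0) ?msupp_uniq //= => /eqP; rewrite addr_eq0 => /eqP e.
have : normc (mcoeff k0 P) * T k0 * t <= S * T k0.
  rewrite -{1}VE -normcM e normc_opp mulrC.
  apply: (@le_trans _ _ (\sum_(k <- msupp P | k != k0) normc (mcoeff k P) * T k0)).
    rewrite (le_trans (ler_wpM2l (ltW t0) (normc_sum _ _ _))) // mulr_sumr.
    rewrite [leLHS]big_seq_cond [leRHS]big_seq_cond; apply: ler_sum => k /andP[kP kk0].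
    by rewrite normcM VE mulrCA ler_wpM2l ?normc_ge0 // Tle.
  rewrite -mulr_suml ler_wpM2r ?(ltW (T0 _)) // /S [leRHS](bigD1_seq k0) ?msupp_uniq //=.
  by rewrite lerDr normc_ge0.
rewrite mulrAC ler_pM2r // -ler_pdivlMl // mulrC.
by rewrite /t gerDr leNgt addr_gt0 // invr_gt0.
Qed.

End Transcendence.

(** * Avoiding countable and finite sets *)

Section CountableSets.

Lemma countable_enum (T : Type) (x0 : T) (A : set T) : countable A ->
  exists g : nat -> T, forall x, A x -> exists n, g n = x.
Proof.
move=> /countable_injP[f finj].
exists (fun n => match pselect (exists2 x, A x & f x = n) with
                 | left e => sval (cid2 e) | right _ => x0 end) => x Ax.
exists (f x); case: pselect => [e|]; last by case; exists x.
case: (cid2 e) => y /= Ay fyx; apply: finj => //; exact/mem_set.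
Qed.

Variable R : realType.

(** A nonempty open interval has positive Lebesgue measure, so it is not contained
    in the countable preimage of A. *)
Lemma avoid_countable (T : Type) (phi : R -> T) (A : set T) (a b : R) :
  injective phi -> countable A -> a < b ->
  exists2 s, a < s < b & ~ A (phi s).
Proof.
move=> inj cA ab; apply: contrapT => noS.
have sub : [set` `]a, b[] `<=` phi @^-1` A.
  move=> s /=; rewrite in_itv /= => sab; apply: contrapT => nA; apply: noS.
  by exists s.
have cI : countable [set` `]a, b[].
  apply: sub_countable (subset_card_le sub) _.
  have /countable_injP[f finj] := cA; apply/countable_injP; exists (f \o phi).
  move=> x y /set_mem Ax /set_mem Ay e; apply/inj/finj => //; exact/mem_set.
have := countable_lebesgue_measure0 cI.
rewrite lebesgue_measure_itv /= lte_fin ab => -[] /eqP.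
by rewrite subr_eq0 gt_eqF.
Qed.

Lemma rat_avoid (l : seq R) (a b : R) : a < b ->
  exists2 q : rat, a < ratr q < b & ratr q \notin l.
Proof.
elim: l a b => [|c l IH] a b ab.
  by have [q] := rat_in_itvoo ab; rewrite in_itv /= => qab; exists q.
pose d := (a + b) / 2; have ad : a < d by rewrite /d; lra.
have db : d < b by rewrite /d; lra.
have [cd|dc] := leP c d.
  have [q /andP[dq qb] ql] := IH _ _ db; exists q; first by rewrite (lt_trans ad).
  by rewrite inE negb_or ql andbT gt_eqF // (le_lt_trans cd).
have [q /andP[aq qd] ql] := IH _ _ ad; exists q; first by rewrite aq (lt_trans qd).
by rewrite inE negb_or ql andbT lt_eqF // (lt_trans qd).
Qed.

End CountableSets.

(** * Algebraic points and a separating linear form *)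

Section AlgebraicNumbers.
Variables (R : realType) (m : nat).
Local Notation C := R[i].

Lemma finite_roots (p : {poly C}) : p != 0 -> finite_set [set x | root p x].
Proof.
move=> p0; have [r pE] := closed_field_poly_normal p.
apply: sub_finite_set (finite_seq r) => x /=.
by rewrite pE rootZ ?lead_coef_eq0 // root_prod_XsubC.
Qed.

Lemma countable_algebraic_numbers : countable (algebraic_numbers : set C).
Proof.
pose ev (p : {poly rat}) := map_poly (ratr : rat -> C) p.
have : countable (\bigcup_(p in [set p : {poly rat} | p != 0]) [set x | root (ev p) x]).
  apply: bigcup_countable => [|p /= p0]; first exact: countableP.
  by apply/finite_set_countable/finite_roots; rewrite map_poly_eq0.
by apply: sub_countable; apply: subset_card_le => x [p p0 px]; exists p.
Qed.

Lemma rat_algebraic (q : rat) : algebraic_numbers (ratr q : C).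
Proof. exact: algebraic_id. Qed.

Lemma conj_algebraic (x : C) : algebraic_numbers x -> algebraic_numbers (conjc x).
Proof.
move=> [p p0 px]; exists p => //.
have -> : map_poly ratr p = map_poly (@conjc R) (map_poly (ratr : rat -> C) p).
  rewrite -map_poly_comp; apply: eq_map_poly => q /=.
  by rewrite fmorph_rat.
by rewrite fmorph_root.
Qed.

Lemma imaginary_algebraic : algebraic_numbers ('i%C : C).
Proof.
exists ('X^2 + 1); first by rewrite -size_poly_eq0 size_polyDl ?size_polyXn ?size_poly1.
rewrite rmorphD /= map_polyXn rmorph1 /root hornerD hornerXn hornerC.
by rewrite sqr_i addNr.
Qed.

Lemma ratr_complex (q : rat) : (ratr q : R)%:C = ratr q :> C.
Proof. exact: (fmorph_rat (real_complex R)). Qed.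

Lemma gauss_algebraic (p q : rat) :
  algebraic_numbers ((ratr p : R)%:C + (ratr q : R)%:C * 'i%C).
Proof.
rewrite !ratr_complex; apply: (algebraic_add (rat_algebraic p)).
exact: algebraic_mul (rat_algebraic q) imaginary_algebraic.
Qed.

Lemma algebraic_enum : exists u : nat -> 'rV[C]_m,
  (forall n, algebraic_points (u n)) /\
  (forall a, algebraic_points a -> exists n, u n = a).
Proof.
have [g gP] := countable_enum 0 countable_algebraic_numbers.
pose h n : C := if `[< algebraic_numbers (g n) >] then g n else 0.
have hA n : algebraic_numbers (h n).
  by rewrite /h; case: asboolP => // _; exact: algebraic0.
have hP x : algebraic_numbers x -> exists n, h n = x.
  move=> Ax; have [n gn] := gP x Ax; exists n; rewrite /h.
  by rewrite gn asboolT.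
have [e eP] := @countable_enum 'rV[nat]_m 0 setT (countableP _).
exists (fun n => map_mx h (e n)).
split=> [n i|a aA]; first by rewrite mxE.
have /choice[k kP] : forall i, exists n, h n = a 0 i by move=> i; apply/hP/aA.
have [n en] := eP (\row_i k i) I; exists n; rewrite en.
by apply/rowP => i; rewrite !mxE kP.
Qed.

(** The coefficient vector of this linear form is a point of the moment curve. *)
Definition moment (t : R) (z : 'rV[C]_m) : C := \sum_(i < m) z 0 i * t%:C ^+ i.

(** Two distinct algebraic points have the same image only if t is a root of the
    nonzero polynomial whose coefficients are the coordinates of their difference. This
    excludes countably many t. As the form has real coefficients it commutes with
    conjugation, so that an algebraic point is real, or conjugate to another one, exactly
    when its image is: a single form reduces questions about points to questions about
    complex numbers. *)
Lemma moment_separates : exists t, forall a b,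
  algebraic_points a -> algebraic_points b -> moment t a = moment t b -> a = b.
Proof.
have [u [uA uP]] := algebraic_enum.
pose bad := \bigcup_(p in [set p : nat * nat | u p.1 != u p.2])
  [set t : R | root (rVpoly (u p.1 - u p.2)) t%:C].
have cbad : countable bad.
  apply: bigcup_countable => [|[i j] /= uij]; first exact: countableP.
  have : countable [set x : C | root (rVpoly (u i - u j)) x].
    apply/finite_set_countable/finite_roots; apply: contra uij => /eqP.
    by move=> e; rewrite -subr_eq0 -[_ - _]rVpolyK e linear0.
  move=> /countable_injP[f finj]; apply/countable_injP.
  exists (f \o real_complex R) => x y /set_mem xr /set_mem yr e.
  by apply/complexI/finj => //; exact/mem_set.
have [t _ tbad] := @avoid_countable R R id bad 0 1 (fun _ _ => id) cbad ltr01.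
exists t => a b aA bA tab; apply: contrapT => ab; apply: tbad.
have [[i ui] [j uj]] := (uP a aA, uP b bA).
exists (i, j) => /=; first by rewrite ui uj; apply/eqP.
rewrite ui uj /root (@horner_coef_wide _ m) ?size_poly //.
rewrite (eq_bigr (fun i : 'I_m => a 0 i * t%:C ^+ i - b 0 i * t%:C ^+ i)).
  by rewrite sumrB -/(moment t a) -/(moment t b) tab subrr.
by move=> k _; rewrite coef_rVpoly_ord !mxE mulrBl.
Qed.

Lemma moment_conj t z : moment t (map_mx conjc z) = conjc (moment t z).
Proof.
rewrite rmorph_sum; apply: eq_bigr => i _.
by rewrite rmorphM rmorphXn /= mxE oppr0.
Qed.

End AlgebraicNumbers.

(** * Small perturbations by real polynomials *)

Section RealPolynomials.
Variables (R : realType) (m : nat).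
Local Notation C := R[i].
Local Notation poly := (mpoly m R).
Implicit Types (p q h : poly) (k j : multinom m) (z : 'rV[C]_m).

Definition ceval p z : C := mmap (real_complex R) (z 0) p.

Lemma cevalD z p q : ceval (p + q) z = ceval p z + ceval q z.
Proof. exact: rmorphD. Qed.

Lemma cevalM z p q : ceval (p * q) z = ceval p z * ceval q z.
Proof. exact: rmorphM. Qed.

Lemma cevalX z p n : ceval (p ^+ n) z = ceval p z ^+ n.
Proof. exact: rmorphXn. Qed.

Lemma cevalZ z (s : R) p : ceval (s *: p) z = s%:C * ceval p z.
Proof. exact: mmapZ. Qed.

Lemma ceval_conj p z : ceval p (map_mx conjc z) = conjc (ceval p z).
Proof.
rewrite /ceval /mmap rmorph_sum; apply: eq_bigr => k _; rewrite rmorphM /= oppr0.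
congr (_ * _); rewrite /mmap1 rmorph_prod; apply: eq_bigr => i _.
by rewrite mxE rmorphXn.
Qed.

(** The order of vanishing at the origin is at least d. *)
Definition order_ge (d : nat) p := forall k, (mdeg k < d)%N -> mcoeff k p = 0.

Lemma order_geW d p q : order_ge d p -> order_ge d (p * q).
Proof.
move=> pd k kd; rewrite mcoeffM big1 // => -[[a _] [b _]] /= /eqP kE.
rewrite pd ?mul0r // (leq_ltn_trans _ kd) // kE mdegD; exact: leq_addr.
Qed.

Lemma order_geM d e p q :
  order_ge d p -> order_ge e q -> order_ge (d + e) (p * q).
Proof.
move=> pd qe k kd; rewrite mcoeffM big1 // => -[[a _] [b _]] /= /eqP kE.
have [ad|da] := ltnP (mdeg a) d; first by rewrite pd ?mul0r.
rewrite qe ?mulr0 // -(ltn_add2l d); apply: leq_ltn_trans kd.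
by rewrite kE mdegD leq_add2r.
Qed.

Lemma order_geX d k : (d <= mdeg k)%N -> order_ge d (mpolyX R k).
Proof. by move=> dk j jd; rewrite mcoeffX; case: eqP jd => // <-; rewrite ltnNge dk. Qed.

Lemma order_ge_exp p d : order_ge 1 p -> order_ge d (p ^+ d).
Proof.
move=> p1; elim: d => [|d IH] //; rewrite exprS -add1n; exact: order_geM.
Qed.

Lemma order_ge_sum (I : eqType) (r : seq I) (F : I -> poly) (s : I -> R) d :
  {in r, forall i, order_ge d (F i)} -> order_ge d (\sum_(i <- r) s i *: F i).
Proof.
move=> Fd k kd; rewrite raddf_sum big1_seq //= => i ir.
by rewrite mcoeffZ Fd // mulr0.
Qed.

(** Multiplying X^k by a polynomial with constant coefficient 1 only adds monomials
    of higher degree, so the part of degree deg k is still X^k. *)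
Lemma mcoeff_Xmul k j q : mcoeff mnm0 q = 1 -> mdeg j = mdeg k ->
  mcoeff j (mpolyX R k * q) = (k == j)%:R.
Proof.
move=> q1 jk; rewrite -[q](subrK 1) mulrDr mulr1 mcoeffD mcoeffX.
rewrite (@order_geM (mdeg k) 1) ?add0r ?addn1 ?jk //; first exact: order_geX.
move=> i; rewrite ltnS leqn0 mdeg_eq0 => /eqP->.
by rewrite mcoeffB q1 mcoeff1 eqxx subrr.
Qed.

Definition bounded_by (delta : multinom m -> R) p :=
  forall k, `|mcoeff k p| <= delta k.

Lemma bounded_byD d1 d2 p q : bounded_by d1 p -> bounded_by d2 q ->
  bounded_by (fun k => d1 k + d2 k) (p + q).
Proof. by move=> b1 b2 k; rewrite mcoeffD (le_trans (ler_normD _ _)) // lerD. Qed.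

(** A finite family of polynomials involves finitely many monomials, so all of its
    combinations with small enough coefficients respect the bounds delta. *)
Lemma bounded_by_comb (I : eqType) (r : seq I) (F : I -> poly) delta :
  (forall k, 0 < delta k) ->
  exists2 e : R, 0 < e & forall s : I -> R, {in r, forall i, `|s i| <= e} ->
    bounded_by delta (\sum_(i <- r) s i *: F i).
Proof.
move=> d0; pose G k := \sum_(i <- r) `|mcoeff k (F i)|.
have G0 k : 0 <= G k by apply: sumr_ge0.
have [e e0 eG] : exists2 e, 0 < e &
    {in flatten [seq msupp (F i) | i <- r], forall k, e * G k <= delta k}.
  elim: (flatten _) => [|k l [e e0 IH]]; first by exists 1.
  exists (Num.min e (delta k / (1 + G k))).
    by rewrite lt_min e0 divr_gt0 // ltr_pwDl.
  move=> j; rewrite inE => /predU1P[->|jl].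
    apply: (@le_trans _ _ (delta k / (1 + G k) * G k)).
      by rewrite ler_wpM2r // ge_min lexx orbT.
    by rewrite -mulrA ler_piMr ?(ltW (d0 k)) // ler_pdivrMl ?ltr_pwDl // mulr1 lerDr.
  by apply: le_trans (IH j jl); rewrite ler_wpM2r // ge_min lexx.
exists e => // s se k; rewrite raddf_sum /=.
have [kF|kF] := boolP (k \in flatten [seq msupp (F i) | i <- r]).
  apply: le_trans (eG k kF); rewrite (le_trans (ler_norm_sum _ _ _)) // mulr_sumr.
  rewrite !big_seq; apply: ler_sum => i ir.
  by rewrite mcoeffZ normrM ler_wpM2r // se.
rewrite big1_seq ?normr0 ?ltW // => i /andP[_ ir].
rewrite mcoeffZ memN_msupp_eq0 ?mulr0 //; apply: contra kF => ki.
by apply/flattenP; exists (msupp (F i)) => //; apply/mapP; exists i.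
Qed.

Variable t : R.
Local Notation Lambda := (moment t).

Definition moment_poly : poly := \sum_(i < m) t ^+ i *: mpolyX R (mnm1 i).

Lemma ceval_moment_poly z : ceval moment_poly z = Lambda z.
Proof.
rewrite /ceval raddf_sum; apply: eq_bigr => i _.
by rewrite /= mmapZ mmapX mmap1U mulrC rmorphXn.
Qed.

Lemma order_moment_poly : order_ge 1 moment_poly.
Proof. by apply: order_ge_sum => i _; apply: order_geX; rewrite mdeg1. Qed.

(** This is (1 - c Lambda)(1 - conj(c) Lambda), written with real coefficients. *)
Definition conj_factor (c : C) : poly :=
  1 - (2 * complex.Re c) *: moment_poly + (normc c ^+ 2) *: moment_poly ^+ 2.

Lemma ceval_conj_factor c z :
  ceval (conj_factor c) z = (1 - c * Lambda z) * (1 - conjc c * Lambda z).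
Proof.
rewrite /conj_factor !cevalD -scaleNr !cevalZ cevalX ceval_moment_poly.
have -> : ceval 1 z = 1 by exact: rmorph1.
have -> : (normc c ^+ 2)%:C = c * conjc c by rewrite -sqr_normc rmorphXn.
have -> : (- (2 * complex.Re c))%:C = - (c + conjc c).
  by rewrite addcJ rmorphN rmorphM rmorph_nat.
by ring.
Qed.

Lemma mcoeff0_conj_factor c : mcoeff mnm0 (conj_factor c) = 1.
Proof.
rewrite /conj_factor !mcoeffD mcoeffN !mcoeffZ mcoeff1 eqxx.
rewrite order_moment_poly ?mdeg0 // (@order_ge_exp _ 2) ?mdeg0 //.
  by rewrite !mulr0 subr0 addr0.
exact: order_moment_poly.
Qed.

(** Real polynomials vanishing where Lambda takes a value in L must also vanish
    where it takes a conjugate value; this one vanishes nowhere else, and it has constant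
    coefficient 1. A zero entry of L contributes the factor 1. *)
Definition vanisher (L : seq C) : poly := \prod_(b <- L) conj_factor b^-1.

Lemma ceval_vanisher L z :
  ceval (vanisher L) z = \prod_(b <- L) ceval (conj_factor b^-1) z.
Proof. exact: rmorph_prod. Qed.

Lemma vanisher0 L z : Lambda z != 0 -> Lambda z \in L -> ceval (vanisher L) z = 0.
Proof.
move=> z0 zL; rewrite ceval_vanisher (big_rem _ zL) /= ceval_conj_factor.
by rewrite mulVf // subrr !mul0r.
Qed.

Let invM_eq1 (b x : C) : b^-1 * x = 1 -> x = b.
Proof.
move=> e; have b0 : b^-1 != 0.
  by apply: contra_eq_neq e => ->; rewrite mul0r eq_sym oner_eq0.
by rewrite -[b]invrK -[RHS]mulr1 -e mulKf.
Qed.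

Lemma vanisher_neq0 L z : Lambda z \notin L -> conjc (Lambda z) \notin L ->
  ceval (vanisher L) z != 0.
Proof.
move=> zL czL; rewrite ceval_vanisher prodf_seq_neq0; apply/allP => b bL /=.
rewrite ceval_conj_factor mulf_neq0 // subr_eq0 eq_sym.
  by apply: contra zL => /eqP/invM_eq1 ->.
apply: contra czL => /eqP e; suff -> : conjc (Lambda z) = b by [].
by apply: invM_eq1; rewrite -[b^-1]conjcK -rmorphM e rmorph1.
Qed.

Lemma mcoeff0_vanisher L : mcoeff mnm0 (vanisher L) = 1.
Proof.
rewrite /vanisher rmorph_prod big1 // => b _; exact: mcoeff0_conj_factor.
Qed.

Definition vanishes_on (L : seq C) p := forall z, Lambda z \in L -> ceval p z = 0.

(** Add to p a combination of the X^k Q, where k runs through the exponents of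
    degree d of p and Q is the vanisher of L: in degree d this changes only the
    coefficients of these X^k, each by an arbitrarily small real number, and makes them
    rational. *)
Lemma rationalize p (L : seq C) d (delta : multinom m -> R) :
  0 \notin L -> (forall k, 0 < delta k) -> exists h,
  [/\ bounded_by delta h, order_ge d h, vanishes_on L h &
      forall k, mdeg k = d -> exists q : rat, mcoeff k (p + h) = ratr q].
Proof.
move=> L0 d0; pose F k := mpolyX R k * vanisher L.
pose r := [seq k <- msupp p | mdeg k == d].
have [e e0 eP] := bounded_by_comb r F d0.
have /choice[s sP] : forall k, exists s : R,
    `|s| <= e /\ exists q : rat, mcoeff k p + s = ratr q.
  move=> k; have := @rat_in_itvoo _ (mcoeff k p) (mcoeff k p + e).
  rewrite ltrDl => /(_ e0)[q]; rewrite in_itv /= => /andP[q1 q2].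
  exists (ratr q - mcoeff k p); split; last by exists q; rewrite addrC subrK.
  by rewrite ger0_norm; lra.
exists (\sum_(k <- r) s k *: F k); split.
- by apply: eP => k _; case: (sP k).
- apply: order_ge_sum => k; rewrite mem_filter => /andP[/eqP kd _].
  by apply/order_geW/order_geX; rewrite kd.
- move=> z zL; rewrite /ceval raddf_sum /= big1 // => k _.
  rewrite -/(ceval _ _) cevalZ cevalM vanisher0 ?mulr0 //.
  by apply: contraNneq L0 => <-.
move=> k kd; rewrite mcoeffD raddf_sum /=.
rewrite (eq_big_seq (fun j => s j * (j == k)%:R)) => [|j]; last first.
  rewrite mem_filter => /andP[/eqP jd _].
  by rewrite mcoeffZ mcoeff_Xmul ?mcoeff0_vanisher // kd jd.
have [kr|kr] := boolP (k \in r).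
  rewrite (bigD1_seq k) ?filter_uniq ?msupp_uniq //= eqxx mulr1.
  rewrite big1 ?addr0 => [|j /negbTE->]; last by rewrite mulr0.
  by case: (sP k).
exists 0; rewrite rmorph0 memN_msupp_eq0 ?add0r.
  rewrite big1_seq // => j /andP[_ jr]; case: eqP jr kr => [->->//|].
  by rewrite mulr0.
by apply: contra kr => kp; rewrite mem_filter kd eqxx.
Qed.

Section Adjust.
Variables (L : seq C) (d : nat) (delta : multinom m -> R) (alpha : 'rV[C]_m) (v0 : C).
Hypotheses (d0 : forall k, 0 < delta k) (L0 : 0 \notin L).
Hypotheses (alpha0 : Lambda alpha != 0) (alphaL : Lambda alpha \notin L)
  (calphaL : conjc (Lambda alpha) \notin L).

(* High order at the origin, zero on L, nonzero at alpha. *)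
Let M : poly := moment_poly ^+ d * vanisher L.
Let G := ceval M alpha.

Let G0 : G != 0.
Proof.
by rewrite /G cevalM cevalX ceval_moment_poly mulf_neq0 ?expf_neq0 // vanisher_neq0.
Qed.

Let M_order p : order_ge d (M * p).
Proof. by do 2![apply: order_geW]; exact: order_ge_exp order_moment_poly. Qed.

Let M_vanishes p : vanishes_on L (M * p).
Proof.
move=> z zL; rewrite !cevalM vanisher0 ?mulr0 ?mul0r //.
by apply: contraNneq L0 => <-.
Qed.

(** The values reached with the real multiples of M form a line, whereas A is
    countable. *)
Lemma adjust_avoid (A : set C) : countable A -> exists h,
  [/\ bounded_by delta h, order_ge d h, vanishes_on L h & ~ A (v0 + ceval h alpha)].
Proof.
move=> cA; have [e e0 eP] := bounded_by_comb [:: tt] (fun=> M * 1) d0.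
have inj : injective (fun s : R => v0 + s%:C * G).
  by move=> x y /addrI/(mulIf G0)/complexI.
have [s /andP[s0 se] sA] := avoid_countable inj cA e0.
exists (s *: (M * 1)); split.
- have := eP (fun=> s); rewrite big_seq1; apply=> _ _.
  by rewrite ger0_norm ltW.
- by move=> k kd; rewrite mcoeffZ M_order // mulr0.
- by move=> z zL; rewrite cevalZ M_vanishes // mulr0.
- by rewrite cevalZ mulr1.
Qed.

(** Adding (s + s' Lambda) M moves the value by (s + s' a) G with s and s' real and
    small. Nearby there are Gaussian rationals outside the finite list l, and rational
    numbers if everything is real; the constraint that the value is real when a is real
    comes from the reality of the coefficients. *)
Lemma adjust_algebraic (l : seq C) :
  (conjc (Lambda alpha) = Lambda alpha -> conjc v0 = v0) -> exists h,
  [/\ bounded_by delta h, order_ge d h, vanishes_on L h &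
      algebraic_numbers (v0 + ceval h alpha) /\ v0 + ceval h alpha \notin l].
Proof.
move=> v0real; set a := Lambda alpha in v0real.
pose F (b : bool) := M * (if b then 1 else moment_poly).
have [e e0 eP] := bounded_by_comb [:: true; false] F d0.
suff [s [s' [se se' [algw wl]]]] : exists s s' : R, [/\ `|s| <= e, `|s'| <= e &
    algebraic_numbers (v0 + (s%:C + s'%:C * a) * G) /\
    v0 + (s%:C + s'%:C * a) * G \notin l].
  exists (s *: F true + s' *: F false); split.
  - have := eP (fun b => if b then s else s'); rewrite big_cons big_seq1; apply.
    by case.
  - by move=> k kd; rewrite mcoeffD !mcoeffZ !M_order // !mulr0 addr0.
  - by move=> z zL; rewrite cevalD !cevalZ !M_vanishes // !mulr0 addr0.
  - suff -> : ceval (s *: F true + s' *: F false) alpha = (s%:C + s'%:C * a) * G by [].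
    rewrite cevalD !cevalZ /F mulr1 [ceval (M * _) _]cevalM ceval_moment_poly -/G -/a.
    by ring.
pose reals := [seq complex.Re w | w <- l].
(* If [a] is real then so are [v0] and [G], and moving along the real line is
   enough; otherwise 1 and [a] span the plane over the reals. *)
have [areal|anreal] := eqVneq (conjc a) a.
  have realE (w : C) : conjc w = w -> w = (complex.Re w)%:C.
    by case: w => x y [] /eqP; rewrite eqNr => /eqP->.
  have vE := realE _ (v0real areal).
  have GE : G = (complex.Re G)%:C.
    apply: realE; rewrite /G -ceval_conj !cevalM !cevalX !ceval_moment_poly moment_conj.
    rewrite -/a areal.
    congr (_ * _).
    rewrite !ceval_vanisher; apply: eq_bigr => b _.
    by rewrite !ceval_conj_factor moment_conj -/a areal.
  set g := complex.Re G in GE; set x := complex.Re v0 in vE.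
  have g0 : g != 0 by apply: contra_neq G0; rewrite GE => ->.
  have eg : x < x + e * `|g| by rewrite ltrDl mulr_gt0 ?normr_gt0.
  have [q /andP[xq qx] ql] := rat_avoid reals eg.
  exists ((ratr q - x) / g), 0; split; rewrite ?normr0 ?(ltW e0) //.
    by rewrite normrM normfV ler_pdivrMr ?normr_gt0 // ger0_norm; lra.
  have -> : v0 + (((ratr q - x) / g)%:C + 0%:C * a) * G = (ratr q)%:C.
    rewrite rmorph0 mul0r addr0 vE GE -rmorphM -rmorphD; congr (_%:C).
    by field.
  split; first by rewrite ratr_complex; exact: rat_algebraic.
  by apply: contra ql => ql; apply/mapP; exists (ratr q)%:C.
have decomp (w : C) : exists x y : R, w = x%:C + y%:C * a.
  have b0 : complex.Im a != 0.
    by apply: contra_neq anreal; case: (a) => x y /= ->; rewrite oppr0.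
  exists (complex.Re w - complex.Im w / complex.Im a * complex.Re a),
         (complex.Im w / complex.Im a).
  case: w (a) b0 => x y [u v] /= v0'; simpc.
  by congr (_ +i* _); field.
have [A1 [B1 E1]] := decomp (G^-1); have [A2 [B2 E2]] := decomp ('i%C / G).
(* Coordinates of a displacement dx + i dy with respect to the basis (G, a G) are
   dx A1 + dy A2 and dx B1 + dy B2, hence at most K times its size. *)
pose K := 1 + `|A1| + `|A2| + `|B1| + `|B2|.
have K0 : 0 < K by rewrite /K !(ltr_wpDr, normr_ge0) //.
pose eta := e / K; have eta0 : 0 < eta by rewrite divr_gt0.
set x := complex.Re v0; set y := complex.Im v0.
have xeta : x < x + eta by rewrite ltrDl.
have yeta : y < y + eta by rewrite ltrDl.
have [q /andP[xq qx] ql] := rat_avoid reals xeta.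
have [q' /andP[yq qy] _] := rat_avoid [::] yeta.
pose dx := ratr q - x; pose dy := ratr q' - y.
have small A B : `|A| + `|B| <= K -> `|dx * A + dy * B| <= e.
  move=> AB; rewrite (le_trans (ler_normD _ _)) // !normrM.
  apply: (@le_trans _ _ (eta * (`|A| + `|B|))).
    by rewrite mulrDr lerD // ler_wpM2r // ger0_norm /dx /dy; lra.
  by rewrite (le_trans (ler_wpM2l (ltW eta0) AB)) // /eta divfK // gt_eqF.
exists (dx * A1 + dy * A2), (dx * B1 + dy * B2).
have nn := (normr_ge0 A1, normr_ge0 A2, normr_ge0 B1, normr_ge0 B2).
split; try by apply: small; rewrite /K; have [[[? ?] ?] ?] := nn; lra.
have -> : v0 + ((dx * A1 + dy * A2)%:C + (dx * B1 + dy * B2)%:C * a) * G =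
    (ratr q)%:C + (ratr q')%:C * 'i%C.
  have -> : ((dx * A1 + dy * A2)%:C + (dx * B1 + dy * B2)%:C * a) =
      dx%:C * (A1%:C + B1%:C * a) + dy%:C * (A2%:C + B2%:C * a).
    by move: dx dy {small} => u w; rewrite !rmorphD !rmorphM /=; ring.
  rewrite -E1 -E2 mulrDl -!mulrA mulVf // !mulr1.
  rewrite [v0]complexE -/x -/y /dx /dy !(rmorphB (real_complex R)). ring.
split; first exact: gauss_algebraic.
apply: contra ql => ql; apply/mapP; exists ((ratr q)%:C + (ratr q')%:C * 'i%C) => //.
by simpc.
Qed.

End Adjust.

End RealPolynomials.

(** * The construction *)

Section Construction.
Variables (R : realType) (m : nat) (hm : (0 < m)%N).
Local Notation C := R[i].
Local Notation poly := (mpoly m R).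
Variables (S : set 'rV[C]_m).
Hypotheses (hconj : conj_closed S) (h0 : S 0).
Variable t : R.
Hypothesis t_sep : forall a b : 'rV[C]_m,
  algebraic_points a -> algebraic_points b -> moment t a = moment t b -> a = b.
Variable u : nat -> 'rV[C]_m.
Hypothesis u_alg : forall n, algebraic_points (u n).
Hypothesis u_surj : forall a, algebraic_points a -> exists n, u n = a.
Variable g : nat -> 'rV[C]_m -> C.

Local Notation conjv := (map_mx (@conjc R)).

Lemma conjvK : involutive (fun z : 'rV[C]_m => conjv z).
Proof. by move=> z; apply/rowP => i; rewrite !mxE conjcK. Qed.

Lemma conjv_algebraic (z : 'rV[C]_m) : algebraic_points z -> algebraic_points (conjv z).
Proof. by move=> az i; rewrite mxE; exact: conj_algebraic. Qed.

Lemma algebraic_points0 : algebraic_points (0 : 'rV[C]_m).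
Proof. by move=> i; rewrite mxE; exact: algebraic0. Qed.

Lemma moment_eq0 (a : 'rV[C]_m) : algebraic_points a -> moment t a = 0 -> a = 0.
Proof.
move=> aA a0; apply: t_sep => //; first exact: algebraic_points0.
by rewrite a0 /moment big1 // => i _; rewrite mxE mul0r.
Qed.

(** The unperturbed function exp(z_1 + ... + z_m); its coefficients are positive and
    rational. *)
Definition exp_series : 'rV[C]_m -> C := psum (fun k => (invfact R k)%:C).

Lemma invfact_dominated : dominated (fun k : multinom m => (invfact R k)%:C) 1.
Proof. by move=> k; rewrite normc_ofreal mul1r ger0_norm // ltW // invfact_gt0. Qed.

Lemma psum_conj (c : multinom m -> R) K z : dominated (fun k => (c k)%:C) K ->
  psum (fun k => (c k)%:C) (conjv z) = conjc (psum (fun k => (c k)%:C) z).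
Proof.
move=> cK; apply: sums_to_uniq (psumP _ cK) _.
apply: sums_to_ext (sums_to_conj (psumP z cK)) => k.
rewrite rmorphM /= oppr0; congr (_ * _); rewrite /mmap1 rmorph_prod.
by apply: eq_bigr => i _; rewrite mxE rmorphXn.
Qed.

(** The value at [u n] can be prescribed unless it is already determined by the value
    at an earlier point or at the conjugate of one. The origin, where the value is the
    constant coefficient, is left out as well. *)
Definition fresh n := [/\ u n != 0, forall i, (i < n)%N -> u i <> u n &
  forall i, (i < n)%N -> conjv (u i) <> u n].

(** The origin is dropped since all perturbations vanish there anyway. *)
Definition processed n : seq C := [seq moment t (u i) | i <- iota 0 n & u i != 0].

Lemma processedP n b : b \in processed n ->
  exists2 i, (i < n)%N & u i != 0 /\ b = moment t (u i).
Proof.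
move=> H; have [j] := elimT (@mapP _ _ (fun i => moment t (u i)) _ b) H.
by rewrite mem_filter mem_iota add0n /= => /andP[uj0 ltj] ->; exists j.
Qed.

(** The allowances of the stages n, n+1, ... add up to 2^-(n+1) times the coefficients
    of the exponential: the limit keeps positive coefficients and converges as fast. *)
Definition budget n (k : multinom m) : R := (2^-1) ^+ n.+2 * invfact R k.

Lemma budget_gt0 n k : 0 < budget n k.
Proof. by rewrite mulr_gt0 ?exprn_gt0 ?invr_gt0 // invfact_gt0. Qed.

(** If the value at [u n] is not among these, the function differs from g_0, ..., g_n. *)
Definition diagonal n : seq C := [seq g j (u n) | j <- iota 0 n.+1].

Definition step_spec n (p h : poly) :=
  [/\ bounded_by (budget n) h, order_ge n.+1 h,
      vanishes_on t (processed n) h,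
      forall k, mdeg k = n.+1 -> exists q : rat, mcoeff k (p + h) = ratr q
    & fresh n -> let w := exp_series (u n) + ceval (p + h) (u n) in
        w \notin diagonal n /\ (algebraic_numbers w <-> S (u n))].

Lemma step n p : exists h, step_spec n p h.
Proof.
have L0 : 0 \notin processed n.
  apply/negP => /processedP[i _ [ui0 /esym/(moment_eq0 (u_alg i)) ui]].
  by rewrite ui eqxx in ui0.
have half : forall k, 0 < budget n.+1 k := budget_gt0 n.+1.
(* The coefficients of degree n+1 are settled first; the value at [u n] is then
   corrected in higher degree, which leaves them alone. *)
have [h1 [b1 o1 v1 r1]] := rationalize t p n.+1 L0 half.
have [h2 [b2 o2 v2 w2]] : exists h2, [/\ bounded_by (budget n.+1) h2,
    order_ge n.+2 h2, vanishes_on t (processed n) h2 &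
    fresh n -> let w := exp_series (u n) + ceval (p + h1) (u n) + ceval h2 (u n) in
        w \notin diagonal n /\ (algebraic_numbers w <-> S (u n))].
  have [[u0 un unc]|nf] := pselect (fresh n); last first.
    exists 0; split=> // [k|k _|z _]; rewrite ?mcoeff0 ?normr0 ?ltW //.
    by rewrite /ceval mmap0.
  have a0 : moment t (u n) != 0 by apply: contra_neq u0 => /(moment_eq0 (u_alg n)).
  have aL : moment t (u n) \notin processed n.
    apply/negP => /processedP[i lt_in [_ e]].
    by apply: (un i lt_in); apply: t_sep.
  have caL : conjc (moment t (u n)) \notin processed n.
    apply/negP => /processedP[i lt_in [_ e]]; apply: (unc i lt_in).
    apply: t_sep => //; first exact: conjv_algebraic.
    by rewrite moment_conj -e conjcK.
  set v0 := exp_series (u n) + ceval (p + h1) (u n).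
  have [Su|nSu] := pselect (S (u n)).
    have vreal : conjc (moment t (u n)) = moment t (u n) -> conjc v0 = v0.
      rewrite -moment_conj => e; rewrite /v0 rmorphD /= -ceval_conj.
      rewrite -(psum_conj _ invfact_dominated) -/exp_series.
      by have -> : conjv (u n) = u n by apply: t_sep e => //; exact: conjv_algebraic.
    have [h [? ? ? [aw wl]]] :=
      adjust_algebraic n.+2 half L0 a0 aL caL (diagonal n) vreal.
    by exists h; split.
  (* Outside S the value has to avoid a countable set. *)
  have cA : countable (algebraic_numbers `|` [set` diagonal n]).
    have -> : algebraic_numbers `|` [set` diagonal n] = \bigcup_(b in [set: bool])
        (if b then algebraic_numbers else [set` diagonal n]).
      apply/seteqP; split=> [x [xA|xl]|x [[] _ xb]].
      - by exists true.
      - by exists false.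
      - by left.
      - by right.
    apply: bigcup_countable => [|[] _]; first exact: countableP.
      exact: countable_algebraic_numbers.
    exact/finite_set_countable/finite_seq.
  have [h [? ? ? wA]] := adjust_avoid n.+2 v0 half L0 a0 aL caL cA.
  exists h; split=> // _ w; split; first by apply/negP => wl; apply: wA; right.
  by split=> // aw; case: wA; left.
exists (h1 + h2); split.
- move=> k; apply: le_trans (bounded_byD b1 b2 k) _.
  by rewrite /budget [_ ^+ n.+3]exprS; lra.
- by move=> k kn; rewrite mcoeffD o1 // o2 ?addr0 // ltnW.
- by move=> z zL; rewrite cevalD v1 // v2 // addr0.
- by move=> k kn; rewrite addrA mcoeffD [mcoeff k h2]o2 ?kn // addr0; exact: r1.
- by move=> fr; have := w2 fr; rewrite /= addrA [ceval (p + h1 + h2) _]cevalD addrA.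
Qed.

Definition choose_step n p : poly := sval (cid (step n p)).

Fixpoint approx n : poly :=
  if n is n'.+1 then approx n' + choose_step n' (approx n') else 0.

Lemma approxP n : step_spec n (approx n) (choose_step n (approx n)).
Proof. exact: (svalP (cid (step n (approx n)))). Qed.

(** Stage n perturbs only coefficients of degree larger than n. *)
Lemma approx_coef_stable k n : (mdeg k <= n)%N ->
  mcoeff k (approx n) = mcoeff k (approx (mdeg k)).
Proof.
move=> /subnK <-; elim: (n - _)%N => // i IH; rewrite addSn /= mcoeffD IH.
case: (approxP (i + mdeg k)) => _ o _ _ _; rewrite o ?addr0 //.
by rewrite ltnS leq_addl.
Qed.

Lemma approx_coef_rat k : exists q : rat, mcoeff k (approx (mdeg k)) = ratr q.
Proof.
case e : (mdeg k) => [|n]; first by exists 0; rewrite mcoeff0 rmorph0.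
by case: (approxP n) => _ _ _ r _; exact: r.
Qed.

Lemma approx_coef_le k n : `|mcoeff k (approx (mdeg k)) - mcoeff k (approx n)| <=
  (2^-1) ^+ n.+1 * invfact R k.
Proof.
have e0 : 0 < invfact R k by exact: invfact_gt0.
have [kn|nk] := leqP (mdeg k) n.
  rewrite approx_coef_stable // subrr normr0 mulr_ge0 ?(ltW e0) //.
  by rewrite exprn_ge0 // invr_ge0.
suff le i : `|mcoeff k (approx (n + i)) - mcoeff k (approx n)| <=
    ((2^-1) ^+ n.+1 - (2^-1) ^+ (n + i).+1) * invfact R k.
  rewrite -(subnKC (ltnW nk)); apply: le_trans (le _) _.
  by rewrite ler_wpM2r ?(ltW e0) // gerBl exprn_ge0 // invr_ge0.
elim: i => [|i IH]; first by rewrite addn0 !subrr normr0 mul0r.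
rewrite addnS /= mcoeffD addrAC (le_trans (ler_normD _ _)) //.
case: (approxP (n + i)) => b _ _ _ _.
apply: le_trans (lerD IH (b k)) _; rewrite /budget -mulrDl ler_wpM2r ?(ltW e0) //.
by rewrite [(2^-1) ^+ (n + i).+2]exprS; lra.
Qed.

Definition coef k : R := invfact R k + mcoeff k (approx (mdeg k)).

Lemma coef_dominated : dominated (fun k => (coef k)%:C) 2.
Proof.
move=> k; rewrite normc_ofreal (le_trans (ler_normD _ _)) //.
have := approx_coef_le k 0; rewrite mcoeff0 subr0 expr1 => le.
have e0 := invfact_gt0 R k; rewrite (gtr0_norm e0); lra.
Qed.

Lemma coef_gt0 k : 0 < coef k.
Proof.
have := approx_coef_le k 0; rewrite mcoeff0 subr0 expr1 ler_norml => /andP[le _].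
have e0 := invfact_gt0 R k; rewrite /coef; lra.
Qed.

Lemma coef_rat k : exists q : rat, coef k = ratr q.
Proof.
have [q qE] := approx_coef_rat k.
exists (\prod_(i < m) ((k i)`!%:R)^-1 + q); rewrite rmorphD /= -qE /coef.
congr (_ + _); rewrite rmorph_prod; apply: eq_bigr => i _.
by rewrite fmorphV rmorph_nat.
Qed.

Definition limit : 'rV[C]_m -> C := psum (fun k => (coef k)%:C).

(** The remainder is a power series whose coefficients are at most 2^-(n+1) times
    those of the exponential. *)
Lemma limit_approx n z : normc (limit z - (exp_series z + ceval (approx n) z)) <=
  (2^-1) ^+ n.+1 * \prod_(i < m) expR (normc (z 0 i)).
Proof.
pose c k := (mcoeff k (approx (mdeg k)) - mcoeff k (approx n))%:C.
have cD : dominated c ((2^-1) ^+ n.+1).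
  by move=> k; rewrite normc_ofreal; exact: approx_coef_le.
suff -> : limit z - (exp_series z + ceval (approx n) z) = psum c z by exact: psum_le.
apply: sums_to_uniq (psumP z cD).
have pS : sums_to (fun k => (mcoeff k (approx n))%:C * mmap1 (z 0) k)
    (ceval (approx n) z).
  apply: sums_to_finite (msupp_uniq _) _ => k /memN_msupp_eq0 ->.
  by rewrite mul0r.
apply: sums_to_ext
  (sums_toB (psumP z coef_dominated) (sums_toD (psumP z invfact_dominated) pS)) => k.
by rewrite -mulrDl -mulrBl -rmorphD -rmorphB /c /coef opprD addrACA subrr add0r.
Qed.

Lemma approx_stable j n : u j != 0 -> (j < n)%N ->
  ceval (approx n) (u j) = ceval (approx j.+1) (u j).
Proof.
move=> uj0 /subnK <-; elim: (n - _)%N => // i IH; rewrite addSn /= cevalD IH.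
case: (approxP (i + j.+1)) => _ _ v _ _; rewrite v ?addr0 //.
apply/mapP; exists j => //; rewrite mem_filter uj0 mem_iota /= add0n.
by rewrite addnS ltnS leq_addl.
Qed.

(** After stage j the value at [u j] is frozen, because the later perturbations vanish
    there, and the remainder tends to 0. *)
Lemma limit_value j : u j != 0 ->
  limit (u j) = exp_series (u j) + ceval (approx j.+1) (u j).
Proof.
move=> uj0; apply/eqP; rewrite -subr_eq0; apply/eqP/eq0_normc/eqP.
set D := normc _; have D0 : 0 <= D by exact: normc_ge0.
pose B : R := \prod_(i < m) expR (normc (u j 0 i)).
have B0 : 0 < B by apply: prodr_gt0 => i _; exact: expR_gt0.
have le n : (j < n)%N -> D <= (2^-1) ^+ n.+1 * B.
  by move=> jn; have := limit_approx n (u j); rewrite approx_stable.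
rewrite eq_le D0 andbT leNgt; apply/negP => Dpos.
pose N := Num.bound (B / D).
have := le (j.+1 + N)%N; rewrite addSn ltnS leq_addr => /(_ isT).
apply/negP; rewrite -ltNge exprVn mulrC ltr_pdivrMr ?exprn_gt0 //.
rewrite mulrC -ltr_pdivrMr //.
have := archi_boundP (divr_ge0 (ltW B0) D0) => /lt_le_trans -> //.
rewrite -natrX ler_nat -/N; apply: leq_trans (ltnW (ltn_expl N (ltnSn 1))) _.
by rewrite leq_exp2l //; do 2!apply: leqW; exact: leq_addl.
Qed.

Lemma limit_conj z : limit (conjv z) = conjc (limit z).
Proof. exact: psum_conj coef_dominated. Qed.

Lemma limit0 : limit 0 = 1.
Proof.
apply: sums_to_uniq (psumP 0 coef_dominated) _.
have e : (coef mnm0)%:C * mmap1 ((0 : 'rV[C]_m) 0) mnm0 = 1.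
  rewrite mmap11 mulr1 /coef mdeg0 mcoeff0 addr0 /invfact big1 // => i _.
  by rewrite mnm0E fact0 invr1.
rewrite -[X in sums_to _ X]e.
rewrite -(big_seq1 +%R mnm0 (fun k => (coef k)%:C * mmap1 ((0 : 'rV[C]_m) 0) k)).
apply: sums_to_finite => // k; rewrite inE => k0.
have [i ki] : exists i, k i != 0%N.
  apply/existsP; apply: contraNT k0 => /existsPn k0.
  by apply/eqP/mnmP => i; rewrite mnm0E; have := k0 i; rewrite negbK => /eqP.
by rewrite /mmap1 (bigD1 i) //= mxE expr0n (negbTE ki) mul0r mulr0.
Qed.

(** A point that is not fresh is the origin, where the value is 1 and which lies in S,
    or an earlier point, or the conjugate of an earlier one; in the last case both sides
    are invariant under conjugation. *)
Lemma limit_algebraic n : algebraic_numbers (limit (u n)) <-> S (u n).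
Proof.
elim/ltn_ind: n => n IH.
have [->|un0] := eqVneq (u n) 0.
  by rewrite limit0; split=> // _; exact: algebraic1.
have [fr|nf] := pselect (fresh n).
  by case: (approxP n) => _ _ _ _ /(_ fr)[_]; rewrite limit_value.
have [[i lt_in e]|noi] := pselect (exists2 i, (i < n)%N & u i = u n).
  by rewrite -e; exact: IH.
have [[i lt_in e]|noc] := pselect (exists2 i, (i < n)%N & conjv (u i) = u n).
  rewrite -e limit_conj; split=> [/conj_algebraic|].
    by rewrite conjcK => /(IH i lt_in)/hconj.
  by move=> /hconj; rewrite conjvK => /(IH i lt_in)/conj_algebraic.
case: nf; split=> // i lt_in e; first by apply: noi; exists i.
by apply: noc; exists i.
Qed.

Lemma exists_fresh j : exists2 n, (j <= n)%N & fresh n.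
Proof.
(* The first occurrence of a point q N with real coordinates is a fresh stage, and
   infinitely many points cannot all occur before stage j. *)
pose q (N : nat) : 'rV[C]_m := const_mx N.+1%:R.
have qA N : algebraic_points (q N).
  by move=> i; rewrite mxE -(ratr_nat C N.+1); exact: rat_algebraic.
have q_inj N N' : q N = q N' -> N = N'.
  by move=> /rowP/(_ (Ordinal hm)); rewrite !mxE => /eqP; rewrite eqr_nat => /eqP[].
have first N : exists n, u n = q N /\ forall i, (i < n)%N -> u i <> q N.
  have ex : exists n, u n == q N by have [n e] := u_surj (qA N); exists n; apply/eqP.
  case: (ex_minnP ex) => n /eqP e H; exists n; split=> // i lt_in /eqP /H.
  by rewrite leqNgt lt_in.
have /choice[v vP] := first.
have [N jN] : exists N, (j <= v N)%N.
  apply: contrapT => /forallNP small.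
  have vj (N : 'I_j.+1) : (v N < j)%N by rewrite ltnNge; apply/negP/small.
  have inj : injective (fun N : 'I_j.+1 => Ordinal (vj N)).
    move=> N N' /(congr1 (@nat_of_ord _)) /= e; apply/val_inj/q_inj.
    by rewrite -(proj1 (vP N)) -(proj1 (vP N')) e.
  by have := leq_card _ inj; rewrite !card_ord ltnn.
have [e H] := vP N; exists (v N) => //; split; rewrite ?e.
- apply/eqP => /rowP/(_ (Ordinal hm)); rewrite !mxE => /eqP.
  by rewrite pnatr_eq0.
- by move=> i /H.
- move=> i /H ne ce; apply: ne; rewrite -[u i]conjvK ce.
  by apply/rowP => k; rewrite !mxE conjc_nat.
Qed.

(** At a fresh stage n >= j the value at [u n] was chosen different from that of
    g_j. *)
Lemma limit_diagonal j : limit <> g j.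
Proof.
move=> e; have [n jn fr] := exists_fresh j.
case: (approxP n) => _ _ _ _ /(_ fr)[+ _]; case: fr => un0 _ _.
have /= <- := limit_value un0; rewrite e => /negP; apply; apply/mapP.
by exists j => //; rewrite mem_iota ltnS.
Qed.

Lemma limit_exceptional : S `<=` algebraic_points -> exceptional_set limit = S.
Proof.
move=> hS; apply/seteqP; split=> [a [aA]|a Sa].
  by have [n <-] := u_surj aA => /limit_algebraic.
have aA := hS _ Sa; split=> //; move: Sa; have [n <-] := u_surj aA.
by move/limit_algebraic.
Qed.

Lemma limit_power_series : power_series_over rationals limit.
Proof.
exists (fun k => (coef k)%:C); split=> [k|z].
  by have [q ->] := coef_rat k; exists q => //; rewrite ratr_complex.
exact/sums_to_cvg/psumP/coef_dominated.
Qed.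

End Construction.

Theorem theorem1 (R : realType) (m : nat) (hm : (0 < m)%N)
    (S : set 'rV[R[i]]_m) (hS : S `<=` algebraic_points)
    (hconj : conj_closed S) (h0 : S 0) :
  ~ countable [set f : 'rV[R[i]]_m -> R[i] |
      [/\ entire f, transcendental f, power_series_over rationals f
        & exceptional_set f = S]].
Proof.
have [t t_sep] := moment_separates R m.
have [u [u_alg u_surj]] := algebraic_enum R m.
move=> /(countable_enum (fun=> 0))[g g_enum].
have coefD := coef_dominated S t_sep u_alg g.
have [|n] := g_enum (limit S t_sep u_alg g).
  split; first exact: entire_psum coefD.
  - by apply: transcendental_psum coefD _ => // k; exact: coef_gt0.
  - exact: limit_power_series.
  - exact: limit_exceptional.
by move=> e; apply: (@limit_diagonal _ _ hm S t t_sep u u_alg u_surj g n).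
Qed.
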